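(* Let $n$ be an integer greater than $2$. There are at least $C_{n-1}$ different equivalence classes under the relation $\sim$ in the set of all $n$-SLTM; that is, $N_n\ge C_{n-1}$.
   Context: Let $\mathbb{F}$ be a field of characteristic different from $2$. An $n$-SLTM is a strictly lower triangular $n\times n$ matrix with entries in $\mathbb{F}$. For an $n$-SLTM $T=[t_{ij}]$, $\mathcal{A}(T)$ is the commutative unital $\mathbb{F}$-algebra with generators $X_1,\dots,X_n$ and relations $X_1^2=0$ and $X_i^2=\sum_{j<i}t_{ij}X_jX_i$ for $2\le i\le n$, graded by $\deg(X_i)=2$. For two $n$-SLTM $T,S$, write $T\sim S$ if there is a degree-preserving isomorphism of $\mathbb{F}$-algebras $\mathcal{A}(T)\to\mathcal{A}(S)$; this is an equivalence relation. $N_n$ denotes the number (possibly infinite) of equivalence classes of $n$-SLTM under $\sim$, and $C_m=\frac{1}{m+1}\binom{2m}{m}$ is the $m$-th Catalan number. *)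

(* Defs.v *)
From HB Require Import structures.
From mathcomp Require Import all_boot all_order all_algebra.
From mathcomp Require Import generic_quotient ring_quotient mpoly.
From mathcomp Require Import boolp classical_sets functions cardinality.

Set Implicit Arguments.
Unset Strict Implicit.
Unset Printing Implicit Defensive.

Import GRing.Theory.

Local Open Scope ring_scope.
Local Open Scope quotient_scope.
Local Open Scope classical_set_scope.
Local Open Scope card_scope.

Definition catalan (m : nat) : nat := 'C(m.*2, m) %/ m.+1.

(* The division in [catalan] is exact. *)
Lemma catalanK (m : nat) : (catalan m * m.+1 = 'C(m.*2, m))%N.
Proof.
rewrite /catalan divnK //.
suff -> : 'C(m.*2, m) = (m.+1 * ('C(m.*2, m) - 'C(m.*2, m.+1)))%N.
  exact: dvdn_mulr.
have e := mul_bin_left m.*2 m.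
rewrite -addnn addnK addnn in e.
by rewrite mulnBr e -mulnBl subSnn mul1n.
Qed.

Section Algebra.

Variables (F : fieldType) (n : nat).
Implicit Types (T S : 'M[F]_n) (p q : {mpoly F[n]}) (d k : nat).

Definition is_sltm T : Prop := forall i j : 'I_n, (i <= j)%N -> T i j = 0.

(* X_i^2 - sum_(j < i) t_ij X_j X_i; the sum is empty for the first index. *)
Definition sltm_rel T (i : 'I_n) : {mpoly F[n]} :=
  'X_i ^+ 2 - \sum_(j < n | (j < i)%N) T i j *: ('X_j * 'X_i).

(* Membership in the ideal generated by the relations, turned into a boolean
   predicate by classical logic as ring_quotient requires. *)
Definition sltm_ideal T : {pred {mpoly F[n]}} := fun p =>
  `[< exists q : 'I_n -> {mpoly F[n]}, p = \sum_i q i * sltm_rel T i >].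

Lemma sltm_idealP T p :
  reflect (exists q : 'I_n -> {mpoly F[n]}, p = \sum_i q i * sltm_rel T i)
          (p \in sltm_ideal T).
Proof. exact: asboolP. Qed.

Lemma sltm_rel_homog T i : sltm_rel T i \is 2.-homog.
Proof.
have hX (j : 'I_n) : ('X_j : {mpoly F[n]}) \is 1.-homog.
  by rewrite dhomogX /= mdeg1.
rewrite /sltm_rel expr2 rpredB ?rpred_sum //; last first.
  by move=> j _; rewrite rpredZ // (dhomogM (hX j) (hX i)).
exact: (dhomogM (hX i) (hX i)).
Qed.

Lemma sltm_ideal_closed T : idealr_closed (sltm_ideal T).
Proof.
split.
- apply/sltm_idealP; exists (fun=> 0).
  by rewrite big1 // => i _; rewrite mul0r.
- apply/negP => /sltm_idealP [q /(congr1 (meval (fun=> 0)))].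
  rewrite meval1 raddf_sum big1 => [|i _] /=; first exact/eqP/oner_neq0.
  rewrite mevalM /sltm_rel mevalB expr2 mevalM !mevalXU mul0r sub0r.
  rewrite (raddf_sum (meval _)) big1 ?oppr0 ?mulr0 //= => j _.
  by rewrite mevalZ mevalM !mevalXU mul0r mulr0.
- move=> a u v /sltm_idealP [q ->] /sltm_idealP [r ->]; apply/sltm_idealP.
  exists (fun i => a * q i + r i).
  by rewrite mulr_sumr -big_split; apply: eq_bigr => i _; rewrite mulrDl mulrA.
Qed.

HB.instance Definition _ T :=
  isIdealr.Build {mpoly F[n]} (sltm_ideal T) (sltm_ideal_closed T).

Definition sltm_alg T := {ideal_quot (sltm_ideal T)}.

HB.instance Definition _ T := GRing.ComNzRing.on (sltm_alg T).
HB.instance Definition _ T := NzRingQuotient.on (sltm_alg T).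

Definition sltm_scale T (c : F) (a : sltm_alg T) : sltm_alg T :=
  \pi_(sltm_alg T) (c *: repr a).

Lemma sltm_piE T p q :
  (\pi_(sltm_alg T) p == \pi_(sltm_alg T) q) = (p - q \in sltm_ideal T).
Proof. by rewrite Quotient.idealrBE. Qed.

Lemma pi_sltm_scale T c p :
  \pi_(sltm_alg T) (c *: p) = sltm_scale c (\pi_(sltm_alg T) p).
Proof.
apply/eqP; rewrite sltm_piE -scalerBr -mul_mpolyC idealMr //.
by rewrite -sltm_piE reprK.
Qed.

Lemma sltm_scaleA T c e (a : sltm_alg T) :
  sltm_scale c (sltm_scale e a) = sltm_scale (c * e) a.
Proof.
elim/quotW: a => p; rewrite -[sltm_scale e _]pi_sltm_scale.
by rewrite -[LHS]pi_sltm_scale -[RHS]pi_sltm_scale scalerA.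
Qed.

Lemma sltm_scale1 T : left_id 1 (@sltm_scale T).
Proof. by elim/quotW=> p; rewrite -pi_sltm_scale scale1r. Qed.

Lemma sltm_scaleDr T : right_distributive (@sltm_scale T) +%R.
Proof.
move=> c; elim/quotW=> p; elim/quotW=> q.
by rewrite -rmorphD -!pi_sltm_scale scalerDr rmorphD.
Qed.

Lemma sltm_scaleDl T (a : sltm_alg T) :
  {morph (@sltm_scale T)^~ a : c e / c + e}.
Proof.
by move=> c e /=; elim/quotW: a => p; rewrite -!pi_sltm_scale scalerDl rmorphD.
Qed.

HB.instance Definition _ T := GRing.Zmodule_isLmodule.Build F (sltm_alg T)
  (@sltm_scaleA T) (@sltm_scale1 T) (@sltm_scaleDr T) (@sltm_scaleDl T).

Lemma sltm_scaleAl T (c : F) (a b : sltm_alg T) : c *: (a * b) = (c *: a) * b.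
Proof.
elim/quotW: a => p; elim/quotW: b => q; rewrite /GRing.scale /=.
by rewrite -rmorphM -!pi_sltm_scale -rmorphM scalerAl.
Qed.

HB.instance Definition _ T :=
  GRing.Lmodule_isLalgebra.Build F (sltm_alg T) (@sltm_scaleAl T).
HB.instance Definition _ T :=
  GRing.Lalgebra_isComAlgebra.Build F (sltm_alg T).

(* The homogeneous component of degree d, the generators having degree 2. *)
Definition sltm_deg T d : set (sltm_alg T) :=
  [set a | exists2 p : {mpoly F[n]},
     (forall m : 'X_{1..n}, m \in msupp p -> (2 * mdeg m)%N = d) &
     a = \pi_(sltm_alg T) p].

Definition sltm_equiv T S : Prop :=
  exists f : {lrmorphism sltm_alg T -> sltm_alg S},
    bijective f /\
    forall d (a : sltm_alg T), sltm_deg d a -> sltm_deg d (f a).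

Lemma sltm_ideal_homog T k p :
  p \in sltm_ideal T -> pihomog mdeg k p \in sltm_ideal T.
Proof.
move=> /sltm_idealP [q ->]; rewrite linear_sum rpred_sum //= => i _.
have rI : sltm_rel T i \in sltm_ideal T.
  apply/sltm_idealP; exists (fun j => (j == i)%:R).
  rewrite (bigD1 i) //= eqxx mul1r big1 ?addr0 // => j /negPf ->.
  by rewrite mul0r.
rewrite (pihomog_partitionE (leqnn (mmeasure mdeg (q i)))) mulr_suml.
rewrite linear_sum rpred_sum //= => e _.
have h := dhomogM (pihomogP mdeg e (q i)) (sltm_rel_homog T i).
have [<-|ne] := eqVneq (e + 2)%N k; last by rewrite (pihomog_ne0 ne h) rpred0.
by rewrite pihomog_dE // idealMr.
Qed.

Lemma sltm_equiv_refl T : sltm_equiv T T.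
Proof.
by exists idfun; split=> //; exists id.
Qed.

Lemma sltm_equiv_trans T S U :
  sltm_equiv T S -> sltm_equiv S U -> sltm_equiv T U.
Proof.
move=> [f [bf hf]] [g [bg hg]]; exists (g \o f); split; first exact: bij_comp.
by move=> d a /hf /hg.
Qed.

Lemma sltm_equiv_sym T S : sltm_equiv T S -> sltm_equiv S T.
Proof.
move=> [f [[g fK gK] hf]].
pose gM := GRing.isMonoidMorphism.Build _ _ g (can2_monoid_morphism fK gK).
pose gL := GRing.isLinear.Build _ _ _ _ g (can2_linear fK gK).
pose G : {lrmorphism sltm_alg S -> sltm_alg T} := HB.pack g gM gL.
exists G; split; first by exists f.
move=> d b [q hq qE]; rewrite /= -/(g b).
pose p := repr (g b); pose K := mmeasure mdeg p.
have pE : g b = \sum_(e < K) \pi_(sltm_alg T) (pihomog mdeg e p).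
  by rewrite -rmorph_sum -(pihomog_partitionE (leqnn K)) /= /p reprK.
have /boolp.choice [s sP] (e : nat) : exists s : {mpoly F[n]}, s \is e.-homog /\
    f (\pi_(sltm_alg T) (pihomog mdeg e p)) = \pi_(sltm_alg S) s.
  have /hf [s hs ->] : sltm_deg (2 * e)
      (\pi_(sltm_alg T) (pihomog mdeg e p) : sltm_alg T).
    exists (pihomog mdeg e p) => // m /(dhomogP _ _ _ (pihomogP mdeg e p)).
    by move=> /= ->.
  exists s; split=> //; apply/dhomogP => m /hs /eqP.
  by rewrite eqn_mul2l => /eqP.
have qsI : q - \sum_(e < K) s e \in sltm_ideal S.
  rewrite -sltm_piE -qE; apply/eqP.
  rewrite -[LHS]gK pE (rmorph_sum f) (rmorph_sum \pi_(sltm_alg S)).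
  by apply: eq_bigr => e _; exact: (sP e).2.
have p0 (e : 'I_K) : (2 * e)%N != d ->
    \pi_(sltm_alg T) (pihomog mdeg e p) = 0.
  move=> ne; apply: (can_inj fK); rewrite (sP e).2 rmorph0.
  apply/eqP; rewrite -(rmorph0 \pi_(sltm_alg S)) sltm_piE subr0.
  have := sltm_ideal_homog e qsI; rewrite pihomogB.
  rewrite (linear_sum (pihomog mdeg e)) /=.
  rewrite (bigD1 e) //= (pihomog_dE (sP e).1) big1 => [|j ne_je]; last first.
    by rewrite (pihomog_ne0 _ (sP j).1).
  rewrite addr0 pihomogE big1_seq ?sub0r ?rpredN // => m /andP[/eqP me /hq].
  by rewrite [mdeg m]me => /eqP; rewrite (negPf ne).
exists (\sum_(e < K | (2 * e)%N == d) pihomog mdeg e p).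
  move=> m /msupp_sum_le /flattenP [l /mapP [e]].
  rewrite mem_filter => /andP[/eqP <- _] -> .
  by move=> /(dhomogP _ _ _ (pihomogP mdeg e p)) /= ->.
rewrite pE rmorph_sum [RHS]big_mkcond; apply: eq_bigr => e _ /=.
by case: ifPn => // /p0.
Qed.

Definition sltm_class T : set 'M[F]_n := [set S | is_sltm S /\ sltm_equiv T S].

Definition sltm_classes : set (set 'M[F]_n) :=
  [set sltm_class T | T in [set T : 'M[F]_n | is_sltm T]].

End Algebra.

Arguments sltm_classes : clear implicits.

(* Main.v *)
(* Fix a nondecreasing sequence a_0 = 1, ..., a_(n-1) with 1 <= a_i and, for
   i > 0, a_i <= i; there are C_(n-1) of these. Let A(a) be the algebra with
   generators Y_i and relations Y_i^2 = (sum_(j < a_i) Y_j)^2, the right-hand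
   side being 0 if a_i = 1. Completing the square, X_i = Y_i + sum_(j < a_i) Y_j, shows that
   A(a) is the algebra of an SLTM.
   The sequence a can be recovered from A(a). If v and w are linear forms in
   the Y_j with v^2 = w^2, and h bounds the indices that occur in them, then
   v and w have the same coefficients at all the products Y_u Y_h with u < h,
   since the relations rewrite Y_k^2 with k <= h in variables of index < h.
   Hence v^2 determines the set of variables of v, unless v has exactly one
   variable; and if h occurs in v but not in w, then v is a multiple of Y_h.
   By induction on i, an isomorphism A(a) -> A(b) sends Y_i to a multiple of
   some Y_(s i) with b_(s i) = a_i, s being a permutation, for all i up to the
   first place i0 where a and b differ. If a_i0 < b_i0, then s maps [0, i0]
   into [0, i0 - 1], which is absurd. *)
Require Import Defs.
From HB Require Import structures.
From mathcomp Require Import all_boot all_order all_algebra.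
From mathcomp Require Import perm.
From mathcomp Require Import generic_quotient mpoly.
From mathcomp Require Import zify ring.
From mathcomp Require boolp.

Set Implicit Arguments.
Unset Strict Implicit.
Unset Printing Implicit Defensive.

Import GRing.Theory.

(** * Counting ladders by ballot numbers *)

Section Ladders.
Local Open Scope nat_scope.

(** Candidate tails a_1, ..., a_r, as heights of a lattice path: nondecreasing, at least v, entry i
    (from 0) at most u + i. *)
Fixpoint ladders (r v u : nat) : seq (seq nat) :=
  if r is r'.+1 then
    [seq x :: l | x <- iota v (u.+1 - v), l <- ladders r' x u.+1]
  else [:: [::]].

(** Split by whether the first entry is v or larger. *)
Lemma laddersS r v u : v <= u ->
  size (ladders r.+1 v u) =
  size (ladders r v u.+1) + size (ladders r.+1 v.+1 u).
Proof. by move=> vu; rewrite /= subSS subSn //= size_cat size_map. Qed.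

(* The ballot number C(2r + d, r) - C(2r + d, r - 1), with the subtraction moved
   to the left-hand side. *)
Lemma size_ladders r v d : size (ladders r v (v + d)) +
  (if r is r'.+1 then 'C(r.*2 + d, r') else 0) = 'C(r.*2 + d, r).
Proof.
elim: r v d => [|r IHr] v d; first by rewrite bin0.
elim: d v => [|d IHd] v; rewrite laddersS ?leq_addr //.
  have -> : size (ladders r.+1 v.+1 (v + 0)) = 0 by rewrite addn0 /= subnn.
  have := IHr v 1; rewrite !addn0 !addn1 doubleS.
  case: r {IHr} => [|r]; first by rewrite bin0 bin1.
  (* The boundary case d = 0 rests on the symmetry C(2r+3, r+2) = C(2r+3, r+1). *)
  have := @bin_sub r.+1.*2.+1 r.+1.
  have -> : r.+1.*2.+1 - r.+1 = r.+2 by lia.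
  by rewrite !binS; lia.
have := IHr v d.+2; have := IHd v.+1; rewrite addSnnS !addnS => {}IHr {}IHd.
have -> : r.+1.*2 + d = (r.*2 + d).+2 by lia.
rewrite doubleS !addSn in IHr IHd *.
by case: r IHr IHd => [|r]; rewrite !(binS, bin0, bin1); lia.
Qed.

(** The ballot number at d = 0 becomes the Catalan number through (m + 1) C(2m, m - 1) = m C(2m,
    m). *)
Lemma size_ladders_catalan m : size (ladders m 1 1) = catalan m.
Proof.
apply/eqP; rewrite -(eqn_pmul2r (ltn0Sn m)) catalanK; apply/eqP.
have := size_ladders m 1 0; rewrite !addn0; case: m => [|r] //.
by have := mul_bin_left r.+1.*2 r; have -> : r.+1.*2 - r = r.+2; nia.
Qed.

Lemma ladders_uniq r v u : uniq (ladders r v u).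
Proof.
elim: r v u => //= r IHr v u; apply: allpairs_uniq_dep => //.
  exact: iota_uniq.
by move=> [x l] [y k] _ _ /= [-> ->].
Qed.

Lemma laddersP r v u l : l \in ladders r v u ->
  [/\ size l = r, path leq v l & forall i, i < r -> nth 0 l i <= u + i].
Proof.
elim: r v u l => [|r IHr] v u l /=; first by rewrite inE => /eqP ->.
case/allpairsPdep => x [k [xv /IHr[sk pk bk] ->]] /=.
move: xv; rewrite mem_iota => xv; split; [by rewrite sk| |].
  by rewrite pk andbT; lia.
by move=> [|i] /= ir; [lia|rewrite addnS; apply: bk].
Qed.
End Ladders.

Local Open Scope ring_scope.
Local Open Scope quotient_scope.

(** * Linear and quadratic parts at the origin *)

Section Jet.
Variables (F : fieldType) (n : nat).
Implicit Types (p q : {mpoly F[n]}) (i j u v : 'I_n) (S T : 'M[F]_n).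

(* First and second partial derivatives at the origin. *)
Definition jet1 u p : F := (p^`M(u))@_0%MM.
Definition jet2 u v p : F := (p^`M(u)^`M(v))@_0%MM.

Lemma jet1E u p : jet1 u p = p@_U_(u).
Proof. by rewrite /jet1 mcoeff_mderiv add0m mnm0E mulr1n. Qed.

Lemma mcoeff0MM p q : (p * q)@_0%MM = p@_0%MM * q@_0%MM.
Proof. exact: (rmorphM (mcoeff 0%MM)). Qed.

Lemma jet1M u p q :
  jet1 u (p * q) = jet1 u p * q@_0%MM + p@_0%MM * jet1 u q.
Proof. by rewrite /jet1 mderivM mcoeffD !mcoeff0MM. Qed.

Lemma jet2M u v p q :
  jet2 u v (p * q) = jet2 u v p * q@_0%MM + jet1 u p * jet1 v q
                   + (jet1 v p * jet1 u q + p@_0%MM * jet2 u v q).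
Proof. by rewrite /jet2 /jet1 !(mderivM, mderivD, mcoeffD, mcoeff0MM). Qed.

Lemma homog1_coef0 p : p \is 1.-homog -> p@_0%MM = 0.
Proof.
move=> /dhomogP hp; apply: memN_msupp_eq0.
by apply: contraL isT => /hp /eqP; rewrite /= mdeg0.
Qed.

Lemma homog1_eq0 p : p \is 1.-homog -> (forall u, jet1 u p = 0) -> p = 0.
Proof.
move=> /dhomogP hp p1; apply/mpolyP => m; rewrite mcoeff0.
have [mp|] := boolP (m \in msupp p); last exact: memN_msupp_eq0.
have /eqP/mdeg1P[u /eqP ->] := hp _ mp.
by rewrite -jet1E.
Qed.

Lemma homogX i : ('X_i : {mpoly F[n]}) \is 1.-homog.
Proof. by rewrite dhomogX /= mdeg1. Qed.

Lemma jet1X u i : jet1 u ('X_i) = (i == u)%:R.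
Proof. by rewrite jet1E mcoeffXU. Qed.

Lemma jet1_linear u : scalar (jet1 u).
Proof. by move=> a p q; rewrite /jet1 mderivD mderivZ mcoeffD mcoeffZ. Qed.
HB.instance Definition _ u :=
  GRing.isLinear.Build F {mpoly F[n]} F *%R (jet1 u) (jet1_linear u).

Lemma jet2_linear u v : scalar (jet2 u v).
Proof. by move=> a p q; rewrite /jet2 !(mderivD, mderivZ, mcoeffD, mcoeffZ). Qed.
HB.instance Definition _ u v :=
  GRing.isLinear.Build F {mpoly F[n]} F *%R (jet2 u v) (jet2_linear u v).

(** The Hessian of the product of the linear forms with coordinates a and b. *)
Definition polar (a b : 'rV[F]_n) : 'M[F]_n := a^T *m b + b^T *m a.

Lemma polarE a b u v : polar a b u v = a 0 u * b 0 v + b 0 u * a 0 v.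
Proof. by rewrite !mxE !big_ord1 !mxE. Qed.

Lemma jet2_homogM p q u v : p \is 1.-homog -> q \is 1.-homog ->
  jet2 u v (p * q) = polar (\row_w jet1 w p) (\row_w jet1 w q) u v.
Proof.
move=> /homog1_coef0 p0 /homog1_coef0 q0.
by rewrite jet2M p0 q0 polarE !mxE mulr0 mul0r add0r addr0 [X in _ + X]mulrC.
Qed.

Lemma sltm_relE T i : is_sltm T ->
  sltm_rel T i = 'X_i * ('X_i - \sum_j T i j *: 'X_j).
Proof.
move=> sT; rewrite /sltm_rel mulrBr expr2; congr (_ - _).
rewrite big_mkcond mulr_sumr; apply: eq_bigr => j _; case: ltnP => hij.
  by rewrite -scalerAr mulrC.
by rewrite sT // scale0r mulr0.
Qed.

Lemma homog_comb (c : 'I_n -> F) (p : 'I_n -> {mpoly F[n]}) :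
  (forall i, p i \is 1.-homog) -> \sum_j c j *: p j \is 1.-homog.
Proof. by move=> hp; apply: rpred_sum => j _; rewrite rpredZ. Qed.

Lemma jet1_comb (c : 'I_n -> F) (p : 'I_n -> {mpoly F[n]}) u :
  jet1 u (\sum_j c j *: p j) = \sum_j c j * jet1 u (p j).
Proof. by rewrite linear_sum; apply: eq_bigr => j _; rewrite linearZ. Qed.

Lemma jet2_rel T i u v : is_sltm T ->
  jet2 u v (sltm_rel T i) = polar (row i 1%:M) (row i (1%:M - T)) u v.
Proof.
move=> sT; rewrite (sltm_relE i sT) jet2_homogM ?rpredB ?homogX //; last first.
  by apply: homog_comb => j; exact: homogX.
congr (polar _ _ u v); apply/rowP => w; rewrite !mxE; first by rewrite jet1X.
rewrite raddfB /= jet1X jet1_comb (bigD1 w) //= big1 => [|j /negPf jw].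
  by rewrite jet1X eqxx mulr1 addr0.
by rewrite jet1X jw mulr0.
Qed.

(** Each relation is a product of two linear forms, so the ideal has no linear terms. *)
Lemma ideal_jet1 T p u : is_sltm T -> p \in sltm_ideal T -> jet1 u p = 0.
Proof.
move=> sT /sltm_idealP[q ->]; rewrite linear_sum big1 //= => k _.
rewrite sltm_relE // !jet1M !mcoeff0MM.
by rewrite (homog1_coef0 (homogX k)) !(mul0r, mulr0, add0r)
  (homog1_coef0 (rpredB (homogX k) (homog_comb _ homogX))) !(mulr0, addr0).
Qed.

Lemma rel_ideal T i : sltm_rel T i \in sltm_ideal T.
Proof.
apply/sltm_idealP; exists (fun j => (j == i)%:R).
rewrite (bigD1 i) //= eqxx mul1r big1 ?addr0 // => j /negPf ->.
by rewrite mul0r.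
Qed.

(* A relation vanishes to second order at 0, so that the Hessian of q * r at 0
   is q(0) times the Hessian of r. *)
Lemma ideal_jet2 T p : is_sltm T -> p \in sltm_ideal T ->
  exists m : 'I_n -> F, \matrix_(u, v) jet2 u v p =
    \sum_k m k *: polar (row k 1%:M) (row k (1%:M - T)).
Proof.
move=> sT /sltm_idealP[q ->]; exists (fun k => (q k)@_0%MM).
apply/matrixP => u v; rewrite mxE linear_sum summxE /=.
apply: eq_bigr => k _; rewrite mxE -jet2_rel // jet2M.
have rel1 w : jet1 w (sltm_rel T k) = 0 := ideal_jet1 w sT (rel_ideal T k).
rewrite !rel1 sltm_relE // mcoeff0MM (homog1_coef0 (homogX k)).
by rewrite !(mul0r, mulr0, add0r, addr0).
Qed.

Lemma sltm_deg_X T i : sltm_deg 2 (\pi_(sltm_alg T) 'X_i).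
Proof.
by exists 'X_i => // m; rewrite msuppX inE => /eqP ->; rewrite mdeg1.
Qed.

Lemma pi0 T : \pi_(sltm_alg T) 0 = 0 :> sltm_alg T.
Proof. exact: rmorph0. Qed.

Lemma piB T p q : \pi_(sltm_alg T) (p - q) =
  \pi_(sltm_alg T) p - \pi_(sltm_alg T) q :> sltm_alg T.
Proof. exact: rmorphB. Qed.

Lemma piM T p q : \pi_(sltm_alg T) (p * q) =
  (\pi_(sltm_alg T) p : sltm_alg T) * \pi_(sltm_alg T) q.
Proof. exact: rmorphM. Qed.

Lemma pi_eq0 T p :
  (\pi_(sltm_alg T) p == 0 :> sltm_alg T) = (p \in sltm_ideal T).
Proof. by rewrite -[in RHS](subr0 p) -sltm_piE pi0. Qed.

Lemma pi_comb T (c : 'I_n -> F) (p : 'I_n -> {mpoly F[n]}) :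
  \pi_(sltm_alg T) (\sum_j c j *: p j) =
  \sum_j c j *: (\pi_(sltm_alg T) (p j) : sltm_alg T).
Proof.
rewrite (rmorph_sum \pi_(sltm_alg T)); apply: eq_bigr => j _ /=.
exact: pi_sltm_scale.
Qed.

(* Row i of P holds the coordinates of the image of X_i. *)
Lemma equiv_polar T S : is_sltm T -> is_sltm S -> sltm_equiv T S ->
  exists2 P : 'M[F]_n, P \in unitmx & forall i, exists m : 'I_n -> F,
    polar (row i P) (row i (P - T *m P)) =
    \sum_k m k *: polar (row k 1%:M) (row k (1%:M - S)).
Proof.
move=> sT sS [f [bf hf]].
have /boolp.choice[p pP] i : exists p : {mpoly F[n]}, p \is 1.-homog /\
    f (\pi_(sltm_alg T) 'X_i) = \pi_(sltm_alg S) p.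
  have /hf[p hp ->] := sltm_deg_X T i; exists p; split=> //.
  by apply/dhomogP => m /hp /(congr1 half); rewrite mul2n doubleK.
have hp i := (pP i).1.
have fE (c : 'I_n -> F) : f (\pi_(sltm_alg T) (\sum_j c j *: 'X_j)) =
    \pi_(sltm_alg S) (\sum_j c j *: p j).
  rewrite !pi_comb linear_sum; apply: eq_bigr => j _.
  by rewrite linearZ /= (pP j).2.
exists (\matrix_(i, u) jet1 u (p i)).
  (* A dependency between the rows kills the same combination of the p_j; as f is injective, that
     combination of the X_j lies in the ideal, hence is 0. *)
  rewrite -row_free_unit -kermx_eq0; apply/rowV0P => c /sub_kermxP c0.
  have s0 : \sum_j c 0 j *: p j = 0.
    apply: homog1_eq0 (homog_comb _ hp) _ => u; rewrite jet1_comb.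
    have /rowP/(_ u) := c0; rewrite !mxE => {2}<-.
    by apply: eq_bigr => j _; rewrite mxE.
  have : \sum_j c 0 j *: 'X_j \in sltm_ideal T.
    by rewrite -pi_eq0 -(inj_eq (bij_inj bf)) fE s0 pi0 !rmorph0.
  move=> cI; apply/rowP => u; have := ideal_jet1 u sT cI.
  rewrite jet1_comb (bigD1 u) //= big1 => [|j /negPf ju]; last first.
    by rewrite jet1X ju mulr0.
  by rewrite jet1X eqxx mulr1 addr0 mxE.
(* The image under f of the i-th relation lies in the ideal of S; [ideal_jet2] reads off its
   Hessian. *)
move=> i; have : p i * (p i - \sum_j T i j *: p j) \in sltm_ideal S.
  rewrite -pi_eq0 piM piB -fE -(pP i).2 -(rmorphB f) -(rmorphM f) -piB -piM.
  rewrite -sltm_relE //; have := rel_ideal T i; rewrite -pi_eq0 => /eqP ->.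
  by rewrite rmorph0.
move=> /(ideal_jet2 sS)[m mE]; exists m; rewrite -mE.
apply/matrixP => u v; rewrite mxE jet2_homogM ?rpredB ?homog_comb //.
congr (polar _ _ u v); apply/rowP => w; rewrite !mxE //.
rewrite raddfB /= jet1_comb; congr (_ - _).
by apply: eq_bigr => j _; rewrite mxE.
Qed.
End Jet.

(** * Linear forms with equal squares, and rigidity of staircases *)

Section Sq.
Variables (F : fieldType) (n : nat).
Implicit Types (p z : 'rV[F]_n) (N Q : 'M[F]_n) (s t : 'I_n).
Implicit Types (h i j k u v : 'I_n).

Definition sq p : 'M[F]_n := p^T *m p.

(* The linear forms p and z have equal squares modulo the relations
   Y_k^2 = (sum_j N_kj Y_j)^2. *)
Definition sqeq N p z := exists m : 'I_n -> F,
  sq p - sq z = \sum_k m k *: (sq (row k 1%:M) - sq (row k N)).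

Lemma sqeq_sym N p z : sqeq N p z -> sqeq N z p.
Proof.
move=> [m mE]; exists (fun k => - m k); rewrite -opprB mE -sumrN.
by apply: eq_bigr => k _; rewrite scaleNr.
Qed.

Lemma sqeq_trans N p q z : sqeq N p q -> sqeq N q z -> sqeq N p z.
Proof.
move=> [m mE] [l lE]; exists (fun k => m k + l k).
rewrite -(subrK (sq q) (sq p)) mE -addrA lE -big_split.
by apply: eq_bigr => k _; rewrite scalerDl.
Qed.

(** The k-th relation, multiplied by c^2. *)
Lemma sqeq_scaled_row N c k p : 
  (forall u, p 0 u = c * (k == u)%:R) -> sqeq N p (c *: row k N).
Proof.
move=> pE; exists (fun j => (j == k)%:R * c ^+ 2).
rewrite (bigD1 k) //= eqxx mul1r big1 ?addr0 => [|j /negPf ->].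
  by apply/matrixP => u v; rewrite !(mxE, big_ord1, pE); ring.
by rewrite mul0r scale0r.
Qed.

Lemma sqeqE N p z : sqeq N p z -> exists m : 'I_n -> F,
  forall u v, p 0 u * p 0 v - z 0 u * z 0 v =
    (u == v)%:R * m u - \sum_k m k * (N k u * N k v).
Proof.
move=> [m mE]; exists m => u v; have /matrixP/(_ u v) := mE.
rewrite !mxE !big_ord1 !mxE => ->; rewrite summxE.
transitivity (\sum_k (m k * ((k == u)%:R * (k == v)%:R) -
                      m k * (N k u * N k v))).
  by apply: eq_bigr => k _; rewrite !mxE !big_ord1 !mxE mulrBr.
rewrite sumrB; congr (_ - _); rewrite (bigD1 u) //= big1 => [|k /negPf ->].
  by rewrite eqxx mul1r addr0 mulrC.
by rewrite mul0r mulr0.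
Qed.

Section StrictlyLower.
Variable N : 'M[F]_n.
Hypothesis sN : is_sltm N.

(** Diagonal entries give m_k = 0 for k > h by descending induction, since only rows below k of N
    reach column k. The rows k <= h of N vanish in column h. *)
Lemma sqeq_top p z h : sqeq N p z ->
    (forall u, (h < u)%N -> p 0 u = 0) -> (forall u, (h < u)%N -> z 0 u = 0) ->
  forall u, u != h -> p 0 u * p 0 h = z 0 u * z 0 h.
Proof.
move=> /sqeqE[m mE] p0 z0.
have m0 k : (h < k)%N -> m k = 0.
  have [r] := ubnP (n - k)%N; elim: r k => // r IH k rk hk.
  have := mE k k; rewrite p0 // z0 // eqxx mul1r big1 => [|j _].
    by rewrite !mul0r !subr0 => <-.
  have [jk|kj] := leqP j k; first by rewrite sN // !mulr0.
  by rewrite IH ?mul0r //; have := ltn_ord j; lia.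
move=> u uh; apply/eqP; rewrite -subr_eq0 mE (negPf uh) mul0r sub0r oppr_eq0.
rewrite big1 // => k _; have [kh|hk] := leqP k h; last by rewrite m0 ?mul0r.
by rewrite (sN kh) !mulr0.
Qed.

Definition supp p : {set 'I_n} := [set u | p 0 u != 0].

(** Let h be the largest index in either support, say that of p. A second variable u of p gives z_u
    z_h = p_u p_h != 0, so z_h != 0; then [sqeq_top] compares all other coordinates. *)
Lemma sqeq_supp p z : sqeq N p z -> #|supp p| != 1%N -> #|supp z| != 1%N ->
  supp p = supp z.
Proof.
move=> pz p1 z1; have [pz0|[h0 h0P]] := set_0Vmem (supp p :|: supp z).
  have /andP[/eqP-> /eqP-> //] : (supp p == set0) && (supp z == set0).
  by rewrite -setU_eq0 pz0.
have [h hP hmax] := @arg_maxnP _ h0 (mem (supp p :|: supp z)) val h0P.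
wlog ph : p z pz p1 z1 h0P hP hmax / h \in supp p.
  move=> W; have /setUP[ph|zh] := hP; first exact: W ph.
  by apply/esym/W => //; rewrite 1?setUC //; apply: sqeq_sym.
have top (w : 'rV[F]_n) : supp w \subset supp p :|: supp z ->
    forall u, (h < u)%N -> w 0 u = 0.
  move=> /subsetP sw u hu; apply/eqP; apply: contraLR hu => wu.
  by rewrite -leqNgt; apply: hmax; apply: sw; rewrite inE.
have eqh := sqeq_top pz (top _ (subsetUl _ _)) (top _ (subsetUr _ _)).
have [u pu uh] : exists2 u, u \in supp p & u != h.
  case: (set_0Vmem (supp p :\ h)) => [p0|[u]].
    case/negP: p1; rewrite (cardsD1 h) ph p0 cards0 //.
  by rewrite in_setD1 => /andP[uh pu]; exists u.
rewrite !inE in ph pu; have zh : z 0 h != 0.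
  apply/eqP => zh0; have /eqP := eqh _ uh; rewrite zh0 mulr0 mulf_eq0.
  by rewrite (negPf pu) (negPf ph).
apply/setP => v; rewrite !inE; have [->|vh] := eqVneq v h.
  by rewrite ph zh.
have /(congr1 (fun x => x == 0)) := eqh _ vh.
by rewrite !mulf_eq0 (negPf ph) (negPf zh) !orbF => ->.
Qed.

End StrictlyLower.

(** Some term of the Leibniz expansion of a nonzero determinant is nonzero. *)
Lemma unitmx_perm Q : Q \in unitmx -> exists s : 'S_n, forall i, Q i (s i) != 0.
Proof.
move=> Qu; have /existsP[s /forallP] :
    [exists s : 'S_n, [forall i, Q i (s i) != 0]].
  apply: contraLR Qu => /existsPn Q0; rewrite unitmxE unitfE negbK.
  apply/eqP; apply: big1 => s _; have /forallPn[i] := Q0 s.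
  by rewrite negbK => /eqP Qi; rewrite (bigD1 i) //= Qi mul0r mulr0.
by exists s.
Qed.

(** The bound [maxn 1 i] forces a_0 = 1 and means a_i <= i for i > 0. *)
Definition profile (a : 'I_n -> nat) :=
  {homo a : i j / (i <= j)%N} /\ forall i, (0 < a i <= maxn 1 i)%N.

(* The row of an index with a_i = 1 is zero. *)
Definition stair (a : 'I_n -> nat) : 'M[F]_n :=
  \matrix_(i, j) ((1 < a i)%N && (j < a i)%N)%:R.

Lemma stair_sltm a : profile a -> is_sltm (stair a).
Proof.
move=> [_ ab] i j ij; rewrite mxE; case: andP => // -[a1 ja].
by have := ab i; lia.
Qed.

Lemma card_lt_ord (m : nat) : (m <= n)%N -> #|[set j : 'I_n | (j < m)%N]| = m.
Proof.
move=> mn; rewrite -sum1_card -[RHS]card_ord -sum1_card.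
rewrite (big_ord_widen _ (fun=> 1%N) mn).
by apply: eq_bigl => j; rewrite inE.
Qed.

Lemma card_stair (m : nat) : (m <= maxn 1 n)%N ->
  #|[set j : 'I_n | (1 < m)%N && (j < m)%N]| = if (1 < m)%N then m else 0%N.
Proof.
move=> mn; case: ifP => m1; last by apply: eq_card0 => j; rewrite inE.
by apply: card_lt_ord; lia.
Qed.

Lemma stair_rigid a b Q : profile a -> profile b -> Q \in unitmx ->
    (forall i, sqeq (stair b) (row i Q) (row i (stair a *m Q))) ->
  forall i0, (forall k, (k < i0)%N -> a k = b k) -> ~ (a i0 < b i0)%N.
Proof.
move=> ap bp Qu Qsq i0 ab ab0; have [s sQ] := unitmx_perm Qu.
have sb := stair_sltm bp.
have main i : (i <= i0)%N -> (forall u, u != s i -> Q i u = 0) /\ b (s i) = a i.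
  have [r] := ubnP i; elim: r i => // r IH i ir ii0.
  have {}IH j : (j < i)%N ->
      (forall u, u != s j -> Q j u = 0) /\ b (s j) = a j.
    by move=> ji; apply: IH; lia.
  have zE u : (stair a *m Q) i u = \sum_(j < n | ((1 < a i) && (j < a i))%N) Q j u.
    rewrite mxE [RHS]big_mkcond; apply: eq_bigr => j _; rewrite mxE.
    by case: ifP; rewrite ?mul1r ?mul0r.
  have [m0 mi] : (0 < a i)%N /\ (1 < a i -> a i <= i)%N.
    by have := ap.2 i; lia.
  (* Earlier rows of Q have a single nonzero entry each, at distinct places s j, so nothing
     cancels. *)
  have z_supp : supp (row i (stair a *m Q)) =
      [set s j | j in [set j : 'I_n | (1 < a i) && (j < a i)]%N].
    apply/setP => u; rewrite inE mxE zE; apply/idP/imsetP => [|[j]].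
      move=> /eqP nz; apply/imsetP; apply: contra_notT nz => nu.
      apply: big1 => j /andP[a1 ja]; apply: (IH j _).1; first lia.
      by apply: contraNneq nu => ->; rewrite imset_f // inE a1.
    rewrite inE => /andP[a1 ja] ->; rewrite (bigD1 j) ?a1 //= big1 ?addr0 //.
    move=> k /andP[ka kj]; apply: (IH k _).1; first lia.
    by rewrite (inj_eq perm_inj) eq_sym.
  have card_z : #|supp (row i (stair a *m Q))| =
      if (1 < a i)%N then a i else 0%N.
    rewrite z_supp card_imset; last exact: perm_inj.
    by apply: card_stair; have := ap.2 i; have := ltn_ord i; lia.
  (* For h the last index in row i of Q, z vanishes from h on; [sqeq_top] then leaves only the entry
     at h, which must be s i. *)
  have Q_supp : forall u, u != s i -> Q i u = 0.
    have [h Qh hmax] := @arg_maxnP _ (s i) (fun u => Q i u != 0) val (sQ i).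
    have Q0 u : (h < u)%N -> Q i u = 0.
      by move=> hu; apply/eqP; apply: contraLR hu => /hmax; rewrite -leqNgt.
    have z0 u : (h <= u)%N -> (stair a *m Q) i u = 0.
      move=> hu; apply/eqP; apply: contraT => zu.
      have : u \in supp (row i (stair a *m Q)) by rewrite inE mxE.
      rewrite z_supp => /imsetP[j]; rewrite inE => /andP[a1 ja] us.
      (* [s] permutes [G], hence [s i \notin G], while [z] only involves
         variables of [G], which is downward closed. *)
      pose G := [set k | (b k < a i)%N].
      (* For k >= i, b_k >= b_i >= a_i: a and b agree before i0, and a_i0 < b_i0. *)
      have Gi k : k \in G -> (k < i)%N.
        rewrite inE; apply: contraLR; rewrite -!leqNgt => ik.
        apply: leq_trans (bp.1 _ _ ik); have [e|ne] := eqVneq i i0.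
          by rewrite e ltnW.
        by rewrite ab // ltn_neqAle ne.
      have sG : s @: G = G.
        apply/eqP; rewrite eqEcard card_imset ?leqnn ?andbT; last exact: perm_inj.
        apply/subsetP => _ /imsetP[k kG ->]; have ki := Gi k kG.
        rewrite inE in kG; rewrite inE (IH k ki).2 ab //; exact: leq_trans ki ii0.
      have siG : s i \notin G.
        rewrite -sG mem_imset; last exact: perm_inj.
        by apply/negP => /Gi; rewrite ltnn.
      (* b_u = a_j <= max(1, j) < a_i. *)
      have uG : (b u < a i)%N.
        rewrite us (IH j _).2; last by have := mi a1; lia.
        by have := ap.2 j; lia.
      rewrite inE -leqNgt in siG.
      by have := leq_trans siG (bp.1 _ _ (leq_trans (hmax _ (sQ i)) hu)); lia.
    have Qh0 u : u != h -> Q i u = 0.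
      have p0 v : (h < v)%N -> row i Q 0 v = 0 by move=> /Q0; rewrite mxE.
      have q0 v : (h < v)%N -> row i (stair a *m Q) 0 v = 0.
        by move=> /ltnW/z0 <-; rewrite [LHS]mxE.
      move=> /(sqeq_top sb (Qsq i) p0 q0) /eqP.
      rewrite ![row _ _ _ _]mxE (z0 h) // mulr0 mulf_eq0 (negPf Qh) orbF.
      by move=> /eqP.
    have <- : h = s i.
      by apply/esym/eqP; apply: contraTT (sQ i) => /Qh0 ->; rewrite eqxx.
    exact: Qh0.
  split=> //.
  have b_supp : supp (Q i (s i) *: row (s i) (stair b)) =
      [set u : 'I_n | (1 < b (s i)) && (u < b (s i))]%N.
    apply/setP => u; rewrite !inE !mxE mulf_eq0 (negPf (sQ i)) /=.
    by case: andP; rewrite ?oner_eq0 ?eqxx.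
  have card_b : #|supp (Q i (s i) *: row (s i) (stair b))| =
      if (1 < b (s i))%N then b (s i) else 0%N.
    rewrite b_supp; apply: card_stair.
    by have := bp.2 (s i); have := ltn_ord (s i); lia.
  have : sqeq (stair b) (Q i (s i) *: row (s i) (stair b)) (row i (stair a *m Q)).
    apply: sqeq_trans (Qsq i); apply: sqeq_sym; apply: sqeq_scaled_row => u.
    rewrite mxE; have [<-|su] := eqVneq (s i) u; first by rewrite mulr1.
    by rewrite mulr0 Q_supp // eq_sym.
  (* Supports of staircase rows have size 0 or at least 2, never 1, so [sqeq_supp] applies; the size
     determines the value, 0 standing for the value 1. *)
  move=> /(sqeq_supp sb); rewrite card_b card_z.
  move=> /(_ _ _)/(congr1 (fun A : {set 'I_n} => #|A|)); rewrite card_b card_z.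
  by have := bp.2 (s i); do 2 case: ifP; lia.
(* Pigeonhole: b_(s i) = a_i <= a_i0 < b_i0 forces s i < i0 for all i <= i0. *)
have : (#|[set s i | i in [set i : 'I_n | (i < i0.+1)%N]]| <= i0)%N.
  rewrite -[X in (_ <= X)%N]card_lt_ord; last exact: ltnW.
  apply: subset_leq_card; apply/subsetP => _ /imsetP[i + ->].
  rewrite !inE ltnS => ii0; have [_ bs] := main _ ii0.
  rewrite ltnNge; apply/negP => /bp.1; rewrite bs => ba.
  by have := ap.1 _ _ ii0; lia.
rewrite card_imset; last exact: perm_inj.
by rewrite card_lt_ord ?ltnn.
Qed.
End Sq.

(** * Completing the square *)

Section Realization.
Variables (F : fieldType) (n : nat).
Implicit Types (N P Q S T : 'M[F]_n) (a b : 'I_n -> nat).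

(* The matrix T for which Y_i = X_i - sum_j T_ij X_j / 2 satisfies
   Y_i^2 = (sum_j N_ij Y_j)^2: this amounts to 1 - T / 2 = (1 + N)^-1. *)
Definition unsquare N : 'M[F]_n := 2 *: (N *m invmx (1%:M + N)).

Lemma unitmx_1D_sltm N : is_sltm N -> 1%:M + N \in unitmx.
Proof.
move=> sN; rewrite unitmxE det_trig.
  by rewrite rpred_prod // => i _; rewrite !mxE eqxx sN // addr0 unitr1.
apply/is_trig_mxP => i j ij; rewrite !mxE sN 1?ltnW // addr0.
by rewrite -val_eqE /= ltn_eqF.
Qed.

(** U = N (1 + N)^-1 satisfies U = N - N U, where row i of N U involves only earlier rows of U. *)
Lemma unsquare_sltm N : is_sltm N -> is_sltm (unsquare N).
Proof.
move=> sN; have Nu := unitmx_1D_sltm sN; rewrite /unsquare.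
set U := N *m _; have UE : U = N - N *m U.
  apply: (canRL (addrK _)); rewrite -{1}[U]mul1mx -mulmxDl.
  rewrite /U mulmxA (_ : (1%:M + N) *m N = N *m (1%:M + N)) ?mulmxK //.
  by rewrite mulmxDl mulmxDr mul1mx mulmx1.
move=> i j ij; rewrite mxE; suff -> : U i j = 0 by rewrite mulr0.
have [r] := ubnP i; elim: r i j ij => // r IH i j ij ir.
rewrite UE !mxE sN // sub0r big1 ?oppr0 // => k _.
have [ki|ik] := ltnP k i; last by rewrite sN ?mul0r.
by rewrite IH ?mulr0 //; lia.
Qed.

(** The identity (Y + L)(Y - L) = Y^2 - L^2, on Hessians. *)
Lemma polar_row (Y L : 'M[F]_n) k :
  polar (row k (Y + L)) (row k (Y - L)) = 2 *: (sq (row k Y) - sq (row k L)).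
Proof. by apply/matrixP => u v; rewrite polarE !(mxE, big_ord1); ring. Qed.

Lemma sq_mul (p : 'rV[F]_n) N : sq (p *m N) = N^T *m sq p *m N.
Proof. by rewrite /sq trmx_mul !mulmxA. Qed.

Hypothesis char_neq2 : 2%N \notin [pchar F].

Lemma unsquare_equiv N N' : is_sltm N -> is_sltm N' ->
    sltm_equiv (unsquare N) (unsquare N') ->
  exists2 Q : 'M[F]_n, Q \in unitmx &
    forall i, sqeq N' (row i Q) (row i (N *m Q)).
Proof.
move=> sN sN' /(equiv_polar (unsquare_sltm sN) (unsquare_sltm sN')) [P Pu PE].
have two0 : 2 != 0 :> F by move: char_neq2; rewrite inE /=.
have Nu := unitmx_1D_sltm sN; have Nu' := unitmx_1D_sltm sN'.
have split_id (M : 'M[F]_n) : is_sltm M ->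
    1%:M = invmx (1%:M + M) + M *m invmx (1%:M + M).
  move=> sM; have Mu := unitmx_1D_sltm sM.
  by rewrite -[X in X + _]mul1mx -mulmxDl mulmxV.
(* Row i holds the image of Y_i, in the X-coordinates of the target. *)
pose Y := invmx (1%:M + N) *m P.
have PD : P = Y + N *m Y by rewrite mulmxA -mulmxDl -split_id // mul1mx.
have PB : P - unsquare N *m P = Y - N *m Y.
  rewrite {1}PD -scalemxAl -mulmxA -/Y scaler_nat mulr2n.
  by rewrite opprD addrA addrK.
(* The factor 1 + N' passes to the Y-coordinates of the target. *)
exists (Y *m (1%:M + N')); first by rewrite !unitmx_mul unitmx_inv Nu Pu.
move=> i; have [m mE] := PE i; exists m.
rewrite mulmxA [row i (Y *m _)]row_mul [row i (_ *m (1%:M + _))]row_mul.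
rewrite !sq_mul -mulmxBl -mulmxBr.
have -> : sq (row i Y) - sq (row i (N *m Y)) =
    \sum_k m k *: (sq (row k (invmx (1%:M + N')))
                   - sq (row k (N' *m invmx (1%:M + N')))).
  apply: (scalerI two0); rewrite -polar_row -PB -PD mE scaler_sumr.
  apply: eq_bigr => k _; rewrite scalerA mulrC -scalerA -polar_row -split_id //.
  rewrite {2}(split_id _ sN') /unsquare scaler_nat mulr2n opprD addrA.
  by rewrite addrK.
rewrite mulmx_sumr mulmx_suml; apply: eq_bigr => k _.
rewrite -scalemxAr -scalemxAl mulmxBr mulmxBl -!sq_mul -!row_mul.
by rewrite mulVmx // mulmxKV.
Qed.

(** At a first disagreement, [stair_rigid] excludes one strict inequality for the isomorphism and
    the other for its inverse. *)
Lemma stair_equiv_eq a b : profile a -> profile b ->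
  sltm_equiv (unsquare (stair F a)) (unsquare (stair F b)) -> a =1 b.
Proof.
move=> ap bp ab; have sa := stair_sltm F ap; have sb := stair_sltm F bp.
have [Q Qu QE] := unsquare_equiv sa sb ab.
have [R Ru RE] := unsquare_equiv sb sa (sltm_equiv_sym ab).
move=> i; have [r] := ubnP i; elim: r i => // r IH i ir.
have abi (k : 'I_n) : (k < i)%N -> a k = b k by move=> ki; apply: IH; lia.
apply/eqP; rewrite eqn_leq; apply/andP; split; rewrite leqNgt; apply/negP.
  exact: (stair_rigid bp ap Ru RE (fun k ki => esym (abi k ki))).
exact: (stair_rigid ap bp Qu QE abi).
Qed.
End Realization.

(** * Distinct ladders give distinct classes *)

Definition ladder_profile n (l : seq nat) (i : 'I_n) : nat :=
  nth 0%N (1%N :: l) i.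

(** Prepending a_0 = 1 shifts indices: entry i of l is a_(i+1), with bound i + 1. *)
Lemma ladder_profileP n l :
  l \in ladders n.-1 1 1 -> profile (@ladder_profile n l).
Proof.
move=> /laddersP[sl pl bl]; split=> [i j ij|i]; rewrite /ladder_profile.
  have sn (k : 'I_n) : (k < size (1%N :: l))%N.
    by rewrite /= sl; have := ltn_ord k; lia.
  exact: (sorted_leq_nth leq_trans leqnn 0%N (pl : sorted leq (1%N :: l)))
    (sn i) (sn j) ij.
case: i => -[|i] //= ilt; have il : (i < n.-1)%N by lia.
have isl : (i < size l)%N by rewrite sl.
have /(all_nthP 0%N)/(_ i isl) := order_path_min leq_trans pl.
by have := bl i il; lia.
Qed.

Lemma ladder_profile_inj n l k :
    l \in ladders n.-1 1 1 -> k \in ladders n.-1 1 1 ->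
  @ladder_profile n l =1 ladder_profile k -> l = k.
Proof.
move=> /laddersP[sl _ _] /laddersP[sk _ _] lk.
apply: (@eq_from_nth _ 0%N) => [|i il]; first by rewrite sl.
have iln : (i.+1 < n)%N by rewrite sl in il; lia.
exact: (lk (Ordinal iln)).
Qed.

From mathcomp Require Import boolp classical_sets functions cardinality.

Local Open Scope ring_scope.
Local Open Scope classical_set_scope.
Local Open Scope card_scope.

Theorem theorem4p1 (F : fieldType) (n : nat) (char_neq2 : 2%N \notin [pchar F])
    (n_gt2 : (2 < n)%N) :
  [set: 'I_(catalan n.-1)] #<= sltm_classes F n.
Proof.
pose L := ladders n.-1 1 1.
pose l (i : 'I_(catalan n.-1)) := nth [::] L i.
have lL i : l i \in L by rewrite mem_nth // size_ladders_catalan.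
pose T i : 'M[F]_n := unsquare (stair F (@ladder_profile n (l i))).
have sT i : is_sltm (T i).
  exact/unsquare_sltm/stair_sltm/ladder_profileP/lL.
pose g i := sltm_class (T i).
have g_inj : {in [set: 'I_(catalan n.-1)] &, injective g}.
  (* Equal classes share the member T j, so T i is equivalent to T j. *)
  move=> i j _ _ gij; have : g j (T j) by split=> //; exact: sltm_equiv_refl.
  rewrite -gij => -[_ /(stair_equiv_eq char_neq2)].
  move=> /(_ (ladder_profileP (lL i)) (ladder_profileP (lL j))).
  move=> /(ladder_profile_inj (lL i) (lL j)) lij; apply/val_inj/eqP.
  rewrite -(nth_uniq [::] _ _ (ladders_uniq n.-1 1 1)).
  - exact/eqP.
  - by rewrite size_ladders_catalan ltn_ord.
  - by rewrite size_ladders_catalan ltn_ord.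
have := inj_card_eq g_inj; rewrite card_eq_le => /andP[_ cardg].
apply: card_le_trans cardg _; apply: subset_card_le.
by move=> _ [i _ <-]; exists (T i); first exact: sT.
Qed.
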